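(* Let $X$ be an almost meshed continuum and let $f\colon X\to X$ be a continuous map. If $\mathrm{Per}(2^f)$ is dense in $2^X$, then $\mathrm{Per}(f)$ is dense in $X$.
   Context: A continuum is a compact, connected, nonempty metric space. An arc is a space homeomorphic to $[0,1]$. An arc $A\subset X$ with endpoints $a,b$ is a free arc in $X$ if $A\setminus\{a,b\}$ is open in $X$. For a continuum $X$ let $\mathcal{FA}(X)=\bigcup\{\mathrm{Int}_X(J): J\text{ is a free arc in }X\}$; $X$ is almost meshed if $\mathcal{FA}(X)$ is dense in $X$. The hyperspace $2^X$ is the set of all nonempty closed subsets of $X$ with the Hausdorff metric, and $2^f\colon 2^X\to 2^X$ is the (continuous) map $2^f(A)=f(A)$. For a continuous self-map $g$, $\mathrm{Per}(g)$ denotes the set of its periodic points, i.e. points $x$ with $g^n(x)=x$ for some $n>0$. *)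

(* Defs.v *)
From HB Require Import structures.
From mathcomp Require Import all_boot all_order all_algebra.
From mathcomp Require Import all_classical all_reals all_analysis.

Set Implicit Arguments.
Unset Strict Implicit.
Unset Printing Implicit Defensive.

Import Order.TTheory GRing.Theory Num.Theory.
Import numFieldNormedType.Exports.

Local Open Scope classical_set_scope.
Local Open Scope ring_scope.

HB.mixin Record Metric_isContinuum (R : realType) X & Metric R X := {
  continuum_compact : compact [set: X] ;
  continuum_connected : connected [set: X] ;
  continuum_nonempty : [set: X] !=set0
}.

#[short(type="continuumType")]
HB.structure Definition Continuum (R : realType) :=
  { X of Metric R X & Metric_isContinuum R X }.

(* Continuity "within" a set is continuity for its subspace topology; the
   values of h and g outside D and E are irrelevant. *)
Definition homeomorphism (T U : topologicalType) (D : set T) (E : set U)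
    (h : T -> U) (g : U -> T) : Prop :=
  [/\ {within D, continuous h}, {within E, continuous g},
      set_fun D E h & set_fun E D g] /\
  (forall x, D x -> g (h x) = x) /\ (forall y, E y -> h (g y) = y).

Definition arc_with_endpoints (R : realType) (X : topologicalType)
    (J : set X) (a b : X) : Prop :=
  exists (h : R -> X) (g : X -> R),
    [/\ homeomorphism (`[0, 1] : set R) J h g, h 0 = a & h 1 = b].

Definition free_arc (R : realType) (X : topologicalType) (J : set X) : Prop :=
  exists a b : X, arc_with_endpoints R J a b /\ open (J `\` [set a; b]).

Definition FA (R : realType) (X : topologicalType) : set X :=
  \bigcup_(J in [set J : set X | free_arc R J]) J°.

Arguments FA : clear implicits.

Definition almost_meshed (R : realType) (X : topologicalType) : Prop :=
  dense (FA R X).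

Definition Per (T : Type) (g : T -> T) : set T :=
  [set x | exists2 n : nat, (0 < n)%N & iter n g x = x].

(* The hyperspace 2^X; its topology is that of the Hausdorff metric below. *)
Record hyperspace (R : realType) (X : continuumType R) : Type := Hyperspace {
  hset :> set X ;
  hset_closed : closed hset ;
  hset_nonempty : hset !=set0
}.

Arguments hset_closed {R X} _.
Arguments hset_nonempty {R X} _.

Section Hausdorff_metric.
Context {R : realType} {X : continuumType R}.
Implicit Types A B C : hyperspace X.

Lemma hyperspace_eq A B : (A : set X) = B -> A = B.
Proof.
case: A B => [A cA A0] [B cB B0] /= AB.
by rewrite -AB in cB B0 *; congr Hyperspace; exact: Prop_irrelevance.
Qed.

HB.instance Definition _ := gen_eqMixin (hyperspace X).
HB.instance Definition _ := gen_choiceMixin (hyperspace X).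

Definition nbhd_within (e : R) (A : set X) : set X :=
  [set x | exists2 a, A a & mdist a x < e].

Definition hausdorff_radii (A B : set X) : set R :=
  [set e | [/\ 0 < e, A `<=` nbhd_within e B & B `<=` nbhd_within e A]].

(* The infimum is over a nonempty set because X is bounded, being compact. *)
Definition hausdorff_dist A B : R := inf (hausdorff_radii A B).

Lemma continuum_bounded :
  exists2 M : R, 0 < M & forall x y : X, mdist x y < M.
Proof.
have [x0 _] := @continuum_nonempty R X.
have /compact_near_coveringP ncX := @continuum_compact R X.
have [M [Mreal XM]] : \forall M \near +oo, [set: X] `<=` [set y | mdist x0 y < M].
  apply: (ncX _ _ (fun (M : R) (y : X) => mdist x0 y < M)) => x _.
  exists (ball x 1, [set M : R | mdist x0 x + 1 < M]).
    split; first exact: nbhsx_ballx.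
    by exists (mdist x0 x + 1); split => //; exact: num_real.
  move=> [y M] /= []; rewrite ballEmdist/= => xy ltM.
  apply: le_lt_trans ltM; apply: (le_trans (metric_triangle _ x _)).
  by rewrite lerD2l ltW.
have {}XM y : mdist x0 y < M + 1 by apply: (XM (M + 1)); rewrite ?ltrDl.
have M0 : 0 < M + 1 by apply: le_lt_trans (XM x0); exact: mdist_ge0.
exists ((M + 1) + (M + 1)); first exact: addr_gt0.
move=> x y; apply: (le_lt_trans (metric_triangle x x0 y)).
by rewrite metric_sym ltrD.
Qed.

Lemma hausdorff_radii_nonempty A B : hausdorff_radii A B !=set0.
Proof.
have [M M0 XM] := continuum_bounded.
have [a Aa] := hset_nonempty A; have [b Bb] := hset_nonempty B.
exists M; split => // x _; [by exists b|by exists a].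
Qed.

Lemma hausdorff_radii_has_lbound A B : has_lbound (hausdorff_radii A B).
Proof. by exists 0 => e [/ltW]. Qed.

Lemma hausdorff_dist_ge0 A B : 0 <= hausdorff_dist A B.
Proof.
by apply: lb_le_inf; [exact: hausdorff_radii_nonempty|move=> e [/ltW]].
Qed.

Lemma hausdorff_dist_lt A B e :
  hausdorff_dist A B < e -> exists2 r, hausdorff_radii A B r & r < e.
Proof. by apply: inf_lt; exact: hausdorff_radii_nonempty. Qed.

Lemma hausdorff_distxx A : hausdorff_dist A A = 0.
Proof.
apply/eqP; rewrite eq_le hausdorff_dist_ge0 andbT.
apply/ler_addgt0Pl => e e0; rewrite addr0.
apply: ge_inf; first exact: hausdorff_radii_has_lbound.
by split => // x Ax; exists x => //; rewrite mdistxx.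
Qed.

Lemma hausdorff_dist_sym A B : hausdorff_dist A B = hausdorff_dist B A.
Proof.
by congr inf; apply/seteqP; split => e [e0 AB BA]; split.
Qed.

Lemma hausdorff_dist_eq0_sub A B : hausdorff_dist A B = 0 -> A `<=` B.
Proof.
move=> AB0 x Ax; apply: hset_closed => U /nbhs_ballP[e /= e0 xeU].
have [r [_ AB _] re] : exists2 r, hausdorff_radii A B r & r < e.
  by apply: hausdorff_dist_lt; rewrite AB0.
have [b Bb bx] := AB _ Ax.
exists b; split => //; apply: xeU.
by rewrite ballEmdist/= metric_sym (lt_trans bx).
Qed.

Lemma hausdorff_dist_positivity A B : hausdorff_dist A B = 0 -> A = B.
Proof.
move=> AB0; apply: hyperspace_eq; apply/seteqP; split.
  exact: hausdorff_dist_eq0_sub.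
by apply: hausdorff_dist_eq0_sub; rewrite hausdorff_dist_sym.
Qed.

Lemma nbhd_within_trans (d e : R) (A B C : set X) :
  A `<=` nbhd_within d B -> B `<=` nbhd_within e C ->
  A `<=` nbhd_within (d + e) C.
Proof.
move=> AB BC x /AB[b /BC[c Cc cb] bx]; exists c => //.
by apply: (le_lt_trans (metric_triangle c b x)); rewrite addrC ltrD.
Qed.

Lemma hausdorff_dist_triangle B A C :
  hausdorff_dist A C <= hausdorff_dist A B + hausdorff_dist B C.
Proof.
apply/ler_addgt0Pl => e e0.
have e20 : 0 < e / 2 by rewrite divr_gt0.
have [r [r0 AB BA] re] : exists2 r, hausdorff_radii A B r &
    r < hausdorff_dist A B + e / 2.
  by apply: hausdorff_dist_lt; rewrite ltrDl.
have [s [s0 BC CB] se] : exists2 s, hausdorff_radii B C s &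
    s < hausdorff_dist B C + e / 2.
  by apply: hausdorff_dist_lt; rewrite ltrDl.
apply: (@le_trans _ _ (r + s)).
  apply: ge_inf; first exact: hausdorff_radii_has_lbound.
  split; [exact: addr_gt0|exact: nbhd_within_trans AB BC|].
  by rewrite addrC; exact: nbhd_within_trans CB BA.
by rewrite [e]splitr addrACA lerD// ltW// addrC.
Qed.

HB.instance Definition _ := isMetric.Build R (hyperspace X)
  hausdorff_distxx hausdorff_dist_positivity hausdorff_dist_sym
  hausdorff_dist_triangle.

Lemma continuum_image_closed (f : X -> X) (cf : continuous f) A :
  closed (f @` A).
Proof.
apply: compact_closed; first exact: metric_hausdorff.
apply: continuous_compact; first exact: continuous_subspaceT.
by apply: subclosed_compact (hset_closed A) (@continuum_compact R X) _.
Qed.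

Lemma continuum_image_nonempty (f : X -> X) A : f @` A !=set0.
Proof. by have [a Aa] := hset_nonempty A; exists (f a), a. Qed.

(* The map 2^f. *)
Definition hyperspace_map (f : X -> X) (cf : continuous f) A : hyperspace X :=
  @Hyperspace R X (f @` A)
    (@continuum_image_closed f cf A) (@continuum_image_nonempty f A).

End Hausdorff_metric.

(* Main.v *)
Require Import Defs.
From HB Require Import structures.
From mathcomp Require Import all_boot all_order all_algebra.
From mathcomp Require Import all_classical all_reals all_analysis.
From mathcomp Require Import lra.

Set Implicit Arguments.
Unset Strict Implicit.
Unset Printing Implicit Defensive.

Import Order.TTheory GRing.Theory Num.Theory.
Import numFieldNormedType.Exports.
Local Open Scope classical_set_scope.
Local Open Scope ring_scope.

(* On a free arc, parametrised by ]0, 1[, take two disjoint subarcs. Density of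
   Per(2^f) yields an iterate g of f and closed sets A1, A2, one inside each
   subarc, with g(A1) = A1 and g(A2) = A2. Let I1 and I2 be the hulls of A1 and
   A2, with I1 on the left. If g has no fixed point on I1, then g moves the left
   end of I1 to the right and its right end to the left within the arc, so the
   image of I1 must leave through its right end and come back from the other
   side, as on a circle: some subinterval K1 of I1 is mapped inside the arc onto
   an interval containing I2. Symmetrically some K2 in I2 is mapped inside the
   arc over I1. The intermediate value theorem then gives a point of K1 fixed
   by g^2. *)

(** * Compact sets of reals and period-two points of interval maps *)

Lemma compact_segment_sub (R : realType) (a b : R) (S : set R) :
  S `<=` `[a, b] ->
  (forall t, a <= t <= b -> ~ S t -> \forall s \near t, ~ S s) ->
  compact S.
Proof.
move=> Sab cS; apply: (subclosed_compact _ (@segment_compact _ a b)) => // t St.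
have tab : a <= t <= b.
  have /= := @itv_closed _ _ a b t (closureS Sab St).
  by rewrite in_itv.
apply: contrapT => /(cS _ tab) nS.
by have [s [Ss]] := St _ nS.
Qed.

Lemma compact_has_max (R : realType) (S : set R) :
  S !=set0 -> compact S -> exists2 c, S c & forall t, S t -> t <= c.
Proof.
move=> S0 cS.
have [|c] := @compact_EVT_max _ _ id S S0 cS.
  by apply: continuous_subspaceT => x; exact: cvg_id.
by rewrite inE => Sc cmax; exists c => // t St; apply: cmax; rewrite inE.
Qed.

Lemma compact_has_min (R : realType) (S : set R) :
  S !=set0 -> compact S -> exists2 c, S c & forall t, S t -> c <= t.
Proof.
move=> S0 cS.
have [|c] := @compact_EVT_min _ _ id S S0 cS.
  by apply: continuous_subspaceT => x; exact: cvg_id.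
by rewrite inE => Sc cmin; exists c => // t St; apply: cmin; rewrite inE.
Qed.

Lemma near_continuous_lt (R : realType) (T : topologicalType) (f g : T -> R) t :
  {for t, continuous f} -> {for t, continuous g} -> f t < g t ->
  \forall s \near t, f s < g s.
Proof.
move=> cf cg fg.
have : (f s - g s) @[s --> t] --> f t - g t by exact: (@cvgB R R^o).
move=> /cvgr_lt /(_ 0); rewrite subr_lt0 => /(_ fg).
by apply: filterS => s; rewrite subr_lt0.
Qed.

(** Each of the segments [[c, e]] and [[c', e']] is stretched by [phi] over the other, so
    [phi (phi x) - x] should go from negative to positive along [[c, e]]. Continuity is asked only
    on the two segments, because between them the map of the application may leave the chart. *)
Lemma period_two_point (R : realType) (phi : R -> R) (c e c' e' : R) :
  c <= e -> c' <= e' ->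
  (forall t, c <= t <= e -> {for t, continuous phi}) ->
  (forall t, c' <= t <= e' -> {for t, continuous phi}) ->
  phi c <= c' -> e' <= phi e -> phi c' < c -> e < phi e' ->
  exists2 x, c <= x <= e & c' <= phi x <= e' /\ phi (phi x) = x.
Proof.
move=> ce ce' cphi cphi' phic phie phic' phie'.
(* Clamping to [c', e'] makes the composite continuous on all of [c, e]; the
   strict bounds on [phi c'] and [phi e'] ensure that it is not active at the
   fixed point. *)
pose rho (x : R) := Num.max c' (Num.min e' x).
have rhoP x : c' <= rho x <= e'.
  by rewrite /rho le_max lexx/= ge_max ce'/= ge_min lexx.
have crho : continuous rho.
  move=> x; apply: (@continuous_max R R (cst c')); first exact: cvg_cst.
  by apply: (@continuous_min R R (cst e')); [exact: cvg_cst|exact: cvg_id].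
pose psi x := phi (rho (phi x)) - x.
have [x xce] : exists2 x, x \in `[c, e] & psi x = 0.
  apply: IVT => //.
    apply: continuous_in_subspaceT => x; rewrite inE/= in_itv/= => xce.
    apply: (@continuousB R R^o R) => //.
    apply: (@continuous_comp _ _ _ (rho \o phi) phi).
      by apply: (@continuous_comp _ _ _ phi rho); [exact: cphi|exact: crho].
    by apply: cphi'; exact: rhoP.
  rewrite /psi.
  have -> : rho (phi c) = c'.
    by rewrite /rho; apply/max_idPl; rewrite ge_min phic orbT.
  have -> : rho (phi e) = e'.
    by rewrite /rho (min_idPl _) //; apply/max_idPr.
  by rewrite ge_min le_max; apply/andP; split; apply/orP; [left|right]; lra.
rewrite in_itv/= in xce; case/andP: xce => cx xe.
move=> /eqP; rewrite subr_eq0 => /eqP xfix.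
have phix : c' <= phi x <= e'.
  apply/andP; split; rewrite leNgt; apply/negP => lt.
    have rE : rho (phi x) = c'.
      by apply/max_idPl; rewrite ge_min (ltW lt) orbT.
    by move: phic'; rewrite -rE xfix ltNge cx.
  have rE : rho (phi x) = e'.
    by rewrite /rho (min_idPl _) ?ltW//; apply/max_idPr.
  by move: phie'; rewrite -rE xfix ltNge xe.
exists x; rewrite ?cx//; split=> //.
rewrite -[RHS]xfix; congr phi; case/andP: phix => h1 h2.
by rewrite /rho (min_idPr h2) (max_idPr h1).
Qed.

(** * Charts of free arcs, and paths leaving a subarc *)

Definition arc_chart (R : realType) (X : topologicalType)
    (h : R -> X) (u : X -> R) (U : set X) : Prop :=
  [/\ open U, forall t, 0 < t < 1 -> {for t, continuous h},
      forall x, U x -> {for x, continuous u},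
      forall t, 0 < t < 1 -> U (h t) /\ u (h t) = t &
      forall x, U x -> 0 < u x < 1 /\ h (u x) = x].

Definition subarc (R : realType) (X : topologicalType)
    (u : X -> R) (U : set X) (a b : R) : set X :=
  [set x | U x /\ a <= u x <= b].

(** The bounds [0 < a] and [b < 1] keep the subarc away from the ends of the chart: it is the image
    of a segment on which [h] is continuous, hence closed in [X] and not only in [U]. *)
Lemma subarc_closed (R : realType) (X : topologicalType) h u (U : set X)
    (a b : R) :
  hausdorff_space X -> arc_chart h u U -> 0 < a -> b < 1 ->
  closed (subarc u U a b).
Proof.
move=> hX [oU ch cu hu uh] a0 b1.
have -> : subarc u U a b = h @` `[a, b].
  apply/seteqP; split=> [x [Ux xab]|_ [t /= + <-]].
    by exists (u x); [rewrite /= in_itv|case: (uh _ Ux)].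
  rewrite in_itv/= => /andP[at_ tb].
  have [|Ut ut] := hu t; first by rewrite (lt_le_trans a0)// (le_lt_trans tb).
  by split=> //; rewrite ut at_.
apply: compact_closed => //.
apply: continuous_compact; last exact: segment_compact.
apply: continuous_in_subspaceT => t; rewrite inE/= in_itv/= => /andP[at_ tb].
by apply: ch; rewrite (lt_le_trans a0)// (le_lt_trans tb).
Qed.

(** In the chart, [p a] lies to the right of [a] and [p b] to the left of [b]. Inside [U] the
    coordinate cannot cross the diagonal, so the path has to run off the right end of the arc, and
    on its way it sweeps from [b] to [y]. *)
Lemma exit_right (R : realType) (X : topologicalType) h u (U : set X)
    (p : R -> X) (a b y : R) :
  hausdorff_space X -> arc_chart h u U ->
  0 < a -> b < y -> y < 1 ->
  (forall t, a <= t <= b -> {for t, continuous p}) ->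
  subarc u U a b (p a) -> subarc u U a b (p b) ->
  (forall t, a <= t <= b -> U (p t) -> u (p t) <> t) ->
  exists c e, [/\ a <= c, c <= e & e <= b] /\
    [/\ u (p c) = b, u (p e) = y & forall t, c <= t <= e -> U (p t)].
Proof.
move=> hX chart a0 by_ y1 cp Wpa Wpb nfix.
have [oU ch cu hu uh] := chart.
have ab : a <= b by case: Wpa => _ /andP[]; exact: le_trans.
have cup t : a <= t <= b -> U (p t) -> {for t, continuous (u \o p)}.
  by move=> tab Upt; apply: continuous_comp; [exact: cp|exact: cu].
have nearU t : a <= t <= b -> U (p t) -> \forall s \near t, U (p s).
  by move=> tab Upt; apply: (cp _ tab U); exact: open_nbhs_nbhs.
have nearW t l m : a <= t <= b -> 0 < l -> m < 1 -> ~ subarc u U l m (p t) ->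
    \forall s \near t, ~ subarc u U l m (p s).
  move=> tab l0 m1 nW; apply: (cp _ tab (~` subarc u U l m)).
  apply: open_nbhs_nbhs; split => //.
  by apply: closed_openC; exact: subarc_closed chart _ _.
(* Take the last [c] with [p c] in the subarc [[c, b]], and then the first [e]
   after it with [p e] outside of the subarc [(e, y)]; in between, [p] stays in
   [(b, y)]. *)
pose C : set R := [set t | a <= t <= b /\ subarc u U t b (p t)].
have cC : compact C.
  apply: (@compact_segment_sub _ a b) => [t [tab _]|t tab nCt].
    by rewrite /= in_itv.
  have [[Upt /andP[aut utb]]|nW] := pselect (subarc u U a b (p t)).
    have utt : u (p t) < t.
      rewrite ltNge; apply/negP => tut; apply: nCt.
      by split => //; split => //; rewrite tut.
    have := near_continuous_lt (cup _ tab Upt) (@cvg_id _ _) utt.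
    apply: filterS => s /= uss [_ [_ /andP[]]].
    by rewrite leNgt uss.
  have := nearW t a b tab a0 (lt_trans by_ y1) nW.
  apply: filterS => s nWs [/andP[as_ sb] [Us /andP[sus usb]]].
  by apply: nWs; split=> //; rewrite usb (le_trans as_).
have [|c [/andP[ac cb] [Upc /andP[cuc ucb]]] cmax] := compact_has_max _ cC.
  by exists a; split; rewrite ?lexx.
have cab : a <= c <= b by rewrite ac.
have cltu : c < u (p c).
  by rewrite lt_neqAle cuc andbT; apply/eqP => /esym; exact: nfix.
have bgtu : u (p b) < b.
  case: Wpb => Upb /andP[_ ubb]; rewrite lt_neqAle ubb andbT; apply/eqP.
  by apply: nfix => //; rewrite lexx ab.
pose S : set R := [set t | c <= t <= b /\ ~ (U (p t) /\ t < u (p t) < y)].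
have cS : compact S.
  apply: (@compact_segment_sub _ c b) => [t [tab _]|t /andP[ct tb] nSt].
    by rewrite /= in_itv.
  have tab : a <= t <= b by rewrite (le_trans ac).
  have [Upt /andP[tut uty]] : U (p t) /\ t < u (p t) < y.
    by apply: contrapT => nn; apply: nSt; split => //; rewrite ct.
  have tu' :=
    @near_continuous_lt _ _ id (u \o p) t cvg_id (cup _ tab Upt) tut.
  have uy' := @near_continuous_lt _ _ (u \o p) (cst y) t
    (cup _ tab Upt) (@cst_continuous _ _ y t) uty.
  near=> s => -[_]; apply; split; first by near: s; exact: nearU.
  by apply/andP; split; near: s; [exact: tu'|exact: uy'].
have [|e [/andP[ce eb] nSe] emin] := compact_has_min _ cS.
  exists b; split; first by rewrite cb lexx.
  by move=> [_ /andP[]]; rewrite ltNge (ltW bgtu).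
have clte : c < e.
  rewrite lt_neqAle ce andbT; apply/eqP => cE; apply: nSe; rewrite -cE.
  by split => //; rewrite cltu (le_lt_trans ucb).
have inW t : c < t < e -> subarc u U b y (p t).
  move=> /andP[ct te].
  have [Upt /andP[tut uty]] : U (p t) /\ t < u (p t) < y.
    apply: contrapT => nn.
    have : S t by split => //; rewrite (ltW ct) (le_trans (ltW te)).
    by move=> /emin; rewrite leNgt te.
  split => //; rewrite (ltW uty) andbT leNgt; apply/negP => utb.
  have : C t.
    split; first by rewrite (le_trans ac (ltW ct)) (le_trans (ltW te)).
    by split => //; rewrite (ltW tut) ltW.
  by move=> /cmax; rewrite leNgt ct.
have b0 : 0 < b by exact: lt_le_trans ab.
have cW := subarc_closed hX chart b0 y1.
(* One-sided limits at [c] and [e] stay in the closed subarc [[b, y]]; together with [u (p c) <= b]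
   this gives [u (p c) = b]. *)
have [_ /andP[buc _]] : subarc u U b y (p c).
  apply: (@closed_cvg _ _ c^'+ _ p _ cW);
    last exact: cvg_at_right_filter (cp _ cab).
  by near=> t; apply: inW; apply/andP; split; near: t;
    [exact: nbhs_right_gt|exact: nbhs_right_lt].
have eab : a <= e <= b by rewrite (le_trans ac).
have Wpe : subarc u U b y (p e).
  apply: (@closed_cvg _ _ e^'- _ p _ cW);
    last exact: cvg_at_left_filter (cp _ eab).
  by near=> t; apply: inW; apply/andP; split; near: t;
    [exact: nbhs_left_gt|exact: nbhs_left_lt].
have [Upe /andP[bue uey]] := Wpe.
exists c, e; split; split => //.
- by apply/eqP; rewrite eq_le ucb.
(* If [u (p e) < y], then [e <= b <= u (p e)] and the absence of fixed points would put [e] outside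
   [S]. *)
- apply/eqP; rewrite eq_le uey/= leNgt; apply/negP => uey'.
  apply: nSe; split => //; rewrite uey' andbT lt_neqAle (le_trans eb bue) andbT.
  by apply/eqP => /esym; exact: nfix.
- move=> t /andP[]; rewrite le_eqVlt => /predU1P[<- //|ct].
  rewrite le_eqVlt => /predU1P[-> //|te].
  by have [] := inW t; rewrite ?ct.
Unshelve. all: by end_near. Qed.

Lemma reverse_continuous (R : realType) (t : R) :
  {for t, continuous (fun s : R => 1 - s)}.
Proof. by apply: (@continuousB R R^o R) => //; exact: cvg_cst. Qed.

(** Reversal exchanges the two ends of the arc, so that [exit_left] is [exit_right] read
    backwards. *)
Lemma arc_chart_reverse (R : realType) (X : topologicalType) (h : R -> X) u U :
  arc_chart h u U ->
  arc_chart (fun t => h (1 - t)) (fun x => 1 - u x) U.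
Proof.
move=> [oU ch cu hu uh].
split => //.
- move=> t t01; have t01' : 0 < 1 - t < 1 by lra.
  exact: (@continuous_comp R R X (fun s => 1 - s) h t
    (@reverse_continuous _ t) (ch _ t01')).

- move=> x Ux; exact: (@continuous_comp X R R u (fun s => 1 - s) x (cu _ Ux)
    (@reverse_continuous _ _)).
- move=> t t01; have [|? ->] := hu (1 - t); first by lra.
  by split => //; lra.
- move=> x Ux; have [? ux] := uh _ Ux; rewrite subKr ux; split => //; lra.
Qed.

Lemma exit_left (R : realType) (X : topologicalType) h u (U : set X)
    (p : R -> X) (a b y : R) :
  hausdorff_space X -> arc_chart h u U ->
  0 < y -> y < a -> b < 1 ->
  (forall t, a <= t <= b -> {for t, continuous p}) ->
  subarc u U a b (p a) -> subarc u U a b (p b) ->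
  (forall t, a <= t <= b -> U (p t) -> u (p t) <> t) ->
  exists e c, [/\ a <= e, e <= c & c <= b] /\
    [/\ u (p e) = y, u (p c) = a & forall t, e <= t <= c -> U (p t)].
Proof.
move=> hX chart y0 ya b1 cp [Ua /andP[aua uab]] [Ub /andP[aub ubb]] nfix.
have [|||||||c [e [[bc ce ea] [uc ue UU]]]] :=
  @exit_right R X _ _ U (fun t => p (1 - t)) (1 - b) (1 - a) (1 - y)
    hX (arc_chart_reverse chart).
- by lra.
- by lra.
- by lra.
- move=> t tab; have tab' : a <= 1 - t <= b by lra.
  exact: (@continuous_comp R R X (fun s => 1 - s) p t
    (@reverse_continuous _ t) (cp _ tab')).
- by rewrite subKr; split => //; lra.
- by rewrite subKr; split => //; lra.
- by move=> t tab Ut ut; apply: (nfix (1 - t)) => //; lra.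
exists (1 - e), (1 - c); do 2![split; try lra].
by move=> t tec; rewrite -[t](subKr 1); apply: UU; lra.
Qed.

Lemma two_periodic_subarcs (R : realType) (X : topologicalType) h u (U : set X)
    (g : X -> X) (a b a' b' : R) :
  hausdorff_space X -> arc_chart h u U -> continuous g ->
  0 < a -> b < a' -> b' < 1 ->
  subarc u U a b (g (h a)) -> subarc u U a b (g (h b)) ->
  subarc u U a' b' (g (h a')) -> subarc u U a' b' (g (h b')) ->
  exists2 t, a <= t <= b' & g (g (h t)) = h t.
Proof.
move=> hX chart cg a0 ba' b'1 Wa Wb Wa' Wb'.
have [_ ch cu hu uh] := chart.
have ab : a <= b by case: Wa => _ /andP[]; exact: le_trans.
have ab' : a' <= b' by case: Wa' => _ /andP[]; exact: le_trans.
apply: contrapT => nper.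
(* A fixed point of [g] is also fixed by its square, so the exit lemmas apply on both subarcs. *)
have nfix t : a <= t <= b' -> U (g (h t)) -> u (g (h t)) <> t.
  move=> tab Ut ut; apply: nper; exists t => //.
  by have [_ ] := uh _ Ut; rewrite ut => e; rewrite -!e.
have cp t : a <= t <= b' -> {for t, continuous (g \o h)}.
  by move=> tab; apply: continuous_comp; [apply: ch; lra|exact: cg].
have [|||||c [e [[ac ce eb] [uc ue Uce]]]] :=
  @exit_right R X h u U (g \o h) a b b' hX chart a0 _ b'1.
- by lra.
- by move=> t tab; apply: cp; lra.
- by [].
- by [].
- by move=> t tab; apply: nfix; lra.
(* Any target in []0, a[] would do in place of [a / 2]: it lies strictly below [c], as
   [period_two_point] demands. *)
have [|||||||e' [c' [[ae' ec' cb'] [ue' uc' Uec']]]] :=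
  @exit_left R X h u U (g \o h) a' b' (a / 2) hX chart.
- by lra.
- by lra.
- by lra.
- by move=> t tab; apply: cp; lra.
- by [].
- by [].
- by move=> t tab; apply: nfix; lra.
have cup t : a <= t <= b' -> U (g (h t)) -> {for t, continuous (u \o (g \o h))}.
  by move=> tab Ut; apply: continuous_comp; [exact: cp|exact: cu].
(* The second segment is [[e', c']]: the leftward exit reaches its far target at the left end
   [e']. *)
have [||||||x xce [phixe phix]] :=
  @period_two_point R (u \o (g \o h)) c e e' c' ce ec'.
- by move=> t tce; apply: cup; [lra|exact: Uce].
- by move=> t tce; apply: cup; [lra|exact: Uec'].
- by rewrite /= uc; lra.
- by rewrite /= ue; lra.
- by rewrite /= ue'; lra.
- by rewrite /= uc'; lra.
apply: nper; exists x; first lra.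
(* Back from coordinates to [X]: both [g (h x)] and its image under [g] lie in [U], where [h]
   inverts [u]. *)
have [_ /= ghx] := uh _ (Uce _ xce).
have [_ /= ghz] := uh _ (Uec' _ phixe).
by rewrite /= in phix; rewrite phix ghx in ghz.
Qed.

(** * Periodic closed sets inside an arc *)

Lemma periodic_set_in_open (R : realType) (X : continuumType R) (f : X -> X)
    (cf : continuous f) (V : set X) :
  dense (Per (hyperspace_map cf)) -> open V -> V !=set0 ->
  exists2 A : hyperspace X, A `<=` V &
    exists2 n : nat, (0 < n)%N & iter n f @` A = A.
Proof.
move=> dper oV [v Vv].
have cv : closed [set v].
  apply: accessible_closed_set1; apply: hausdorff_accessible.
  exact: metric_hausdorff.
pose v' : hyperspace X := @Hyperspace R X [set v] cv (ex_intro _ v erefl).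
(* A closed set at Hausdorff distance less than [e] from the singleton of [v] lies in the [e]-ball
   around [v], hence in [V]. *)
have /nbhs_ballP[e /= e0 eV] : nbhs v V by exact: open_nbhs_nbhs.
have [|A [vA [n n0 An]]] := dper (ball v' e)° _ (open_interior _).
  by exists v'; apply: nbhsx_ballx.
exists A.
  move: (interior_subset vA); rewrite ballEmdist/= => /hausdorff_dist_lt.
  move=> [r [_ _ Av] re] x /Av[_ -> vx].
  by apply: eV; rewrite ballEmdist/= (lt_trans vx).
exists n => //; rewrite -[in RHS]An.
(* Iterating the map of the hyperspace amounts to taking images under the iterates of [f]. *)
elim: n {n0 An} => [|n IH]; first by rewrite image_id.
by rewrite [RHS]/= -IH image_comp.
Qed.

(** The ends of the hull of [A] in the chart are attained on [A], so [g] sends them into [A] and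
    thus into the hull; nothing is claimed about the points in between. *)
Lemma periodic_subarc (R : realType) (X : topologicalType) h u (U A : set X)
    (g : X -> X) (a b : R) :
  arc_chart h u U -> compact A -> A !=set0 ->
  A `<=` [set x | U x /\ a < u x < b] -> g @` A = A ->
  exists a' b', [/\ a < a', b' < b,
    subarc u U a' b' (g (h a')) & subarc u U a' b' (g (h b'))].
Proof.
move=> [oU ch cu hu uh] cA [x0 Ax0] AU gA.
have cuA : compact (u @` A).
  apply: continuous_compact => //; apply: continuous_in_subspaceT => x.
  by rewrite inE => /AU[Ux _]; exact: cu.
have u0 : u @` A !=set0 by exists (u x0), x0.
have [_ [x Ax <-] xmin] := compact_has_min u0 cuA.
have [_ [y Ay <-] ymax] := compact_has_max u0 cuA.
have inA z : A z -> subarc u U (u x) (u y) z.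
  move=> Az; split; first by have [] := AU _ Az.
  by rewrite xmin ?ymax//; exists z.
have gin z : A z -> A (g z) by move=> Az; rewrite -gA; exists z.
have [Ux /andP[ax _]] := AU _ Ax; have [Uy /andP[_ yb]] := AU _ Ay.
exists (u x), (u y).
have [_ ->] := uh _ Ux; have [_ ->] := uh _ Uy.
by split => //; apply: inA; exact: gin.
Qed.

Lemma iter_image_mul (T : Type) (f : T -> T) (A : set T) (m n : nat) :
  iter n f @` A = A -> iter (m * n) f @` A = A.
Proof.
move=> An; elim: m => [|m IH]; first by rewrite image_id.
have -> : iter (m.+1 * n) f = iter n f \o iter (m * n) f.
  by apply/funext => x; rewrite mulSn iterD.
by rewrite -image_comp IH An.
Qed.
Lemma iter_continuous (T : topologicalType) (f : T -> T) (n : nat) :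
  continuous f -> continuous (iter n f).
Proof.
move=> cf; elim: n => [|n IH] x; first exact: cvg_id.
by apply: (@continuous_comp _ _ _ (iter n f) f); [exact: IH|exact: cf].
Qed.

(** * From free arcs to charts *)

Lemma free_arc_chart (R : realType) (X : topologicalType) (J : set X)
    (h : R -> X) (u : X -> R) :
  homeomorphism (`[0, 1] : set R) J h u ->
  open (J `\` [set h 0; h 1]) -> arc_chart h u (J `\` [set h 0; h 1]).
Proof.
move=> [[ch cu hJ uI] [uh hu]] oU.
have JI x : J x -> 0 <= u x <= 1 by move/uI; rewrite /= in_itv.
have II t : 0 <= t <= 1 -> `[0, 1]%classic t by rewrite /= in_itv.
split => //.
- move=> t t01.
  (* On an open set, relative continuity is continuity at each point; the same argument serves for
     [u], as [J] without its endpoints is open. *)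
  have /= : {in `]0, 1[%classic, continuous h}.
    rewrite -continuous_open_subspace; last exact: itv_open.
    by apply: continuous_subspaceW ch; exact: subset_itv_oo_cc.
  by apply; rewrite inE/= in_itv.
- move=> x Ux.
  have /= : {in J `\` [set h 0; h 1], continuous u}.
    rewrite -continuous_open_subspace//.
    by apply: continuous_subspaceW cu => ? [].
  by apply; rewrite inE.
- move=> t t01; have It : `[0, 1]%classic t by apply: II; lra.
  split; last exact: uh.
  split; first exact: hJ.
  by case=> /(congr1 u); rewrite !uh//; try (apply: II; lra); lra.
- move=> x [Jx /= xh]; split; last exact: hu.
  have := JI _ Jx; rewrite !le_eqVlt.
  move=> /andP[/predU1P[u0|->] /predU1P[u1|->]] //;
    exfalso; apply: xh; [left|left|right].
  + by rewrite u0 hu.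
  + by rewrite u0 hu.
  + by rewrite -u1 hu.
Qed.

(** A point of [J] in [O] may be an endpoint of the arc. The preimage of [O] is relatively open in
    [[0, 1]], so the parameter can be pushed slightly inwards. *)
Lemma free_arc_dense_interior (R : realType) (X : topologicalType) (J O : set X)
    (h : R -> X) (u : X -> R) :
  homeomorphism (`[0, 1] : set R) J h u -> open O -> J `&` O !=set0 ->
  exists2 t, 0 < t < 1 & O (h t).
Proof.
move=> [[ch cu hJ uI] [uh hu]] oO [x [Jx Ox]].
have Iu : 0 <= u x <= 1 by have := uI _ Jx; rewrite /= in_itv.
have Oux : O (h (u x)) by rewrite hu.
have : within `[0, 1] (nbhs (u x)) (h @^-1` O).
  rewrite nbhs_subspace_in; last by rewrite /= in_itv.
  by apply: (ch (u x) O); apply: open_nbhs_nbhs.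
move=> /nbhs_ballP[e /= e0 eO].
have [s s01 us] : exists2 s, 0 < s < 1 & `|u x - s| < e.
  pose d := Num.min e 1 / 2.
  have d0 : 0 < d by rewrite divr_gt0// lt_min e0 ltr01.
  have [de d1] : d <= e / 2 /\ d <= 1 / 2.
    by split; rewrite ler_pM2r// ge_min lexx ?orbT.
  (* The shift goes towards the middle and is at most [1 / 4], so it cannot overshoot the other
     end. *)
  have [x2|x2] := ltP (u x) (1 / 2);
    [exists (u x + d / 2)|exists (u x - d / 2)];
    rewrite ?ltr_norml; lra.
by exists s => //; apply: eO => //=; rewrite in_itv/=; lra.
Qed.

(** * Density of the periodic points of [f] *)

Theorem theorem7p3 (R : realType) (X : continuumType R) (f : X -> X)
    (cf : continuous f) :
  almost_meshed R X ->
  dense (Per (hyperspace_map cf)) ->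
  dense (Per f).
Proof.
move=> meshed dper O O0 oO.
have hX : hausdorff_space X by exact: metric_hausdorff.
have [x [Ox [J [a [b [[h [u [hom h0 h1]]] oU]]] Jx]]] := meshed _ O0 oO.
rewrite -{}h0 -{}h1 in oU.
have chart := free_arc_chart hom oU.
have [t0 t01 Oh0] : exists2 t, 0 < t < 1 & O (h t).
  apply: free_arc_dense_interior hom oO _; exists x; split=> //.
  exact: interior_subset.
have [t00 t0_lt1] := andP t01.
set U := J `\` _ in oU chart.
have [_ ch cu hu uh] := chart.
have [al [be [/andP[al0 alt] /andP[tbe be1] hO]]] : exists al be,
    [/\ 0 < al < t0, t0 < be < 1 & forall t, al < t < be -> O (h t)].
  have /nbhs_ballP[r /= r0 rO] : nbhs t0 (h @^-1` O).
    by apply: (ch _ t01 O); exact: open_nbhs_nbhs.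
  pose d := Num.min r (Num.min t0 (1 - t0)).
  have d0 : 0 < d by rewrite !lt_min r0; lra.
  have dr : d <= r by rewrite ge_min lexx.
  have dt : d <= t0 by rewrite !ge_min lexx orbT.
  have dt' : d <= 1 - t0 by rewrite !ge_min lexx !orbT.
  exists (t0 - d / 2), (t0 + d / 2); split; try lra.
  move=> t tab; apply: rO; rewrite /ball/= ltr_norml; lra.
have openV l m : open [set y | U y /\ l < u y < m].
  rewrite openE => y [Uy /andP[ly ym]].
  have lu := @near_continuous_lt _ _ (cst l) u y
    (@cst_continuous _ _ l y) (cu _ Uy) ly.
  have um := @near_continuous_lt _ _ u (cst m) y
    (cu _ Uy) (@cst_continuous _ _ m y) ym.
  near=> z; split; first by near: z; exact: open_nbhs_nbhs.
  by apply/andP; split; near: z; [exact: lu|exact: um].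
have V0 l m : 0 < l -> l < m -> m < 1 -> [set y | U y /\ l < u y < m] !=set0.
  move=> l0 lm m1; have [|? ul] := hu ((l + m) / 2); first lra.
  by exists (h ((l + m) / 2)); split => //; rewrite ul; lra.
(* The parameter [t0] separates the two sets, which makes their hulls disjoint. *)
have [A1 A1V [n1 n10 fA1]] :=
  periodic_set_in_open dper (openV al t0) (V0 al t0 al0 alt t0_lt1).
have [A2 A2V [n2 n20 fA2]] :=
  periodic_set_in_open dper (openV t0 be) (V0 t0 be t00 tbe be1).
(* The product is a common period, so one map preserves both sets. *)
pose g := iter (n1 * n2) f.
have cg : continuous g by exact: iter_continuous.
have compA (A : hyperspace X) : compact A.
  by apply: subclosed_compact (@continuum_compact R X) _; [exact: hset_closed|].
have gA1 : g @` A1 = A1 by rewrite /g mulnC; exact: iter_image_mul.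
have gA2 : g @` A2 = A2 by exact: iter_image_mul.
have [a1 [b1 [ala1 b1t W1 W1']]] :=
  periodic_subarc chart (compA A1) (hset_nonempty A1) A1V gA1.
have [a2 [b2 [ta2 b2be W2 W2']]] :=
  periodic_subarc chart (compA A2) (hset_nonempty A2) A2V gA2.
have [|||t tab gt] :=
  two_periodic_subarcs hX chart cg _ _ _ W1 W1' W2 W2'; try lra.
exists (h t); split; first by apply: hO; lra.
(* The period is doubled because the point is fixed by the square of [g]. *)
exists ((n1 * n2) + (n1 * n2))%N; first by rewrite addn_gt0 muln_gt0 n10 n20.
by rewrite iterD.
Unshelve. all: by end_near. Qed.
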